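(* Let $G$ and $H$ be finitely generated residually nilpotent groups and set $\tau=\tau(G)$. Suppose that $\phi:G\to H$ is a lower central $\tau$-monomorphism. Then $H$ is para-$G$ via $\phi$, and $\tau(H)=\tau$.
   Context: For a group $G$, $\gamma_1(G)=G$, $\gamma_{i+1}(G)=[\gamma_i(G),G]$ is the lower central series and $G_{ab}=G/\gamma_2(G)$. A group is residually nilpotent if $\bigcap_{i}\gamma_i(G)=1$. For a group $K$ and $n\in\mathbb{N}$, $K^n$ is the subgroup generated by all $n$-th powers of elements of $K$. For $n\in\mathbb{N}$ (positive), $\pi(n)$ is the set of primes dividing $n$. For a set of primes $\pi$, $\pi'$ is its complement in the set of all primes; $n$ is a $\pi$-number if $\pi(n)\subseteq\pi$ and a $\pi'$-number if $\pi(n)\subseteq\pi'$. For a finitely generated group $G$, $\tau(G)=\bigcup_{i=1}^\infty \pi\big(|\mathrm{Tor}(\gamma_i(G)/\gamma_{i+1}(G))|\big)$, where $\mathrm{Tor}$ denotes the torsion subgroup (finite here). Lower central $\tau$-monomorphism (with $\tau=\tau(G)$): a monomorphism $\phi:G\to H$ which induces an isomorphism $G_{ab}\cong H_{ab}$ and for which there exist $\tau'$-numbers $n_i$ such that $\gamma_i(H)^{n_i}\le\phi(\gamma_i(G))$ for all $i\ge2$. $H$ is para-$G$ via $\phi$ if $\phi:G\to H$ is a monomorphism such that the induced map $\phi_i:G/\gamma_i(G)\to H/\gamma_i(H)$ is an isomorphism for every $i$. *)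

(* Defs.v *)
From HB Require Import structures.
From mathcomp Require Import all_boot.
From mathcomp Require Import boolp classical_sets functions cardinality.

Set Implicit Arguments.
Unset Strict Implicit.
Unset Printing Implicit Defensive.

Local Open Scope classical_set_scope.
Local Open Scope quotient_scope.
Local Open Scope card_scope.
Local Open Scope group_scope.

(* A groupType may be infinite; its choiceType structure is no restriction *)
(* classically. Subgroups are Prop-valued sets. *)

Notation "{ 'gmorphism' G -> H }" := (UMagmaMorphism.type G H)
  (at level 0, G at level 98, H at level 99) : type_scope.

Section Subgroups.
Variable G : groupType.
Implicit Types A B K : set G.

Definition subgroup K : Prop :=
  K 1 /\ forall x y, K x -> K y -> K (x / y).

Definition normal K : Prop :=
  subgroup K /\ forall x y, K x -> K (x ^ y).

Definition generated A : set G := smallest subgroup A.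

Definition commutator_subgroup A B : set G :=
  generated [set [~ x, y] | x in A & y in B].

Definition power_subgroup K n : set G := generated [set x ^+ n | x in K].

Definition finitely_generated : Prop :=
  exists2 A : set G, finite_set A & generated A = setT.

Lemma sub_generated A : A `<=` generated A.
Proof. exact: sub_gen_smallest. Qed.

Lemma generated_subgroup A : subgroup (generated A).
Proof.
split=> [K [[]]//|x y Kx Ky K KA]; have [[_ KF] _] := KA.
by apply: KF; [apply: Kx|apply: Ky].
Qed.

Lemma generated_min A K : subgroup K -> A `<=` K -> generated A `<=` K.
Proof. by move=> sK AK; apply: smallest_sub. Qed.

Lemma generated_normal A :
  (forall x y, A x -> A (x ^ y)) -> normal (generated A).
Proof.
move=> AJ; split; first exact: generated_subgroup.
move=> x y; move: x; apply: (@generated_min A [set x | generated A (x ^ y)]).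
- have [g1 gF] := generated_subgroup A; split=> /= [|u v gu gv].
    by rewrite conj1g.
  by rewrite conjMg conjVg; apply: gF.
- by move=> x Ax; apply: sub_generated; apply: AJ.
Qed.

End Subgroups.

Arguments finitely_generated : clear implicits.

Section LowerCentralSeries.
Variable G : groupType.

(* gamma G 0 is a dummy value: the series starts at gamma G 1 = G. *)
Fixpoint gamma (i : nat) : set G :=
  if i isn't j.+1 then setT
  else if j is _.+1 then commutator_subgroup (gamma j) setT else setT.

End LowerCentralSeries.

Arguments gamma : clear implicits.

Definition residually_nilpotent (G : groupType) : Prop :=
  \bigcap_(i in [set i | (1 <= i)%N]) gamma G i = [set 1].

Section Quotient.
Variable G : groupType.

Record normal_subgroup := NormalSubgroup {
  normal_set :> set G;
  normal_setP : normal normal_set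
}.

Variable N : normal_subgroup.

Definition coset_rel (x y : G) : bool := `[< normal_set N (x^-1 * y) >].

Lemma normal1 : normal_set N 1. Proof. by have [[]] := normal_setP N. Qed.

Lemma normalF x y : normal_set N x -> normal_set N y -> normal_set N (x / y).
Proof. by have [[_ NF] _] := normal_setP N; apply: NF. Qed.

Lemma normalV x : normal_set N x -> normal_set N x^-1.
Proof. by rewrite -[x^-1]mul1g; apply: normalF; apply: normal1. Qed.

Lemma normalM x y : normal_set N x -> normal_set N y -> normal_set N (x * y).
Proof. by move=> Nx Ny; rewrite -[y]invgK; apply/normalF/normalV. Qed.

Lemma normalJ x y : normal_set N x -> normal_set N (x ^ y).
Proof. by have [_] := normal_setP N; apply. Qed.

Lemma coset_rel_refl : reflexive coset_rel.
Proof. by move=> x; apply/asboolP; rewrite mulVg; apply: normal1. Qed.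

Lemma coset_rel_sym : symmetric coset_rel.
Proof.
move=> x y; apply/asboolP/asboolP => /normalV; by rewrite invgM invgK.
Qed.

Lemma coset_rel_trans : transitive coset_rel.
Proof.
move=> y x z /asboolP Nxy /asboolP Nyz; apply/asboolP.
by have := normalM Nxy Nyz; rewrite mulgA mulgK.
Qed.

Canonical coset_equiv :=
  EquivRel coset_rel coset_rel_refl coset_rel_sym coset_rel_trans.

Definition quotient : Type := {eq_quot coset_rel}.

HB.instance Definition _ := Choice.on quotient.
HB.instance Definition _ := EqQuotient.on quotient.

Definition coset (x : G) : quotient := \pi_quotient x.

Lemma coset_repr (a : quotient) : coset (repr a) = a.
Proof. exact: reprK. Qed.

Lemma quotient_ind (P : quotient -> Prop) :
  (forall x, P (coset x)) -> forall a, P a.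
Proof. by move=> Px a; rewrite -(coset_repr a). Qed.

Lemma coset_eqP (x y : G) : coset x = coset y <-> normal_set N (x^-1 * y).
Proof. by split=> [/eqquotP/asboolP|Nxy] //; apply/eqquotP/asboolP. Qed.

Lemma repr_coset x : normal_set N ((repr (coset x))^-1 * x).
Proof. by apply/coset_eqP; rewrite coset_repr. Qed.

Definition quotient_one : quotient := coset 1.
Definition quotient_mul (a b : quotient) : quotient := coset (repr a * repr b).
Definition quotient_inv (a : quotient) : quotient := coset (repr a)^-1.

Lemma quotient_mulE x y : quotient_mul (coset x) (coset y) = coset (x * y).
Proof.
apply/coset_eqP; have := repr_coset x; have := repr_coset y.
set u := repr (coset x); set v := repr (coset y) => Ny Nx.
have -> : (u * v)^-1 * (x * y) = (u^-1 * x) ^ v * (v^-1 * y).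
  by rewrite /conjg invgM !mulgA mulgK.
by apply: normalM => //; apply: normalJ.
Qed.

Lemma quotient_invE x : quotient_inv (coset x) = coset x^-1.
Proof.
apply/coset_eqP; have := repr_coset x; set u := repr _ => Nx.
have -> : u^-1^-1 / x = ((u^-1 * x)^-1) ^ u^-1.
  by rewrite /conjg !invgM !invgK mulgK.
by apply: normalJ; apply: normalV.
Qed.

Lemma quotient_mulA : associative quotient_mul.
Proof.
move=> a b c; elim/quotient_ind: a => x; elim/quotient_ind: b => y.
by elim/quotient_ind: c => z; rewrite !quotient_mulE mulgA.
Qed.

Lemma quotient_mul1 : left_id quotient_one quotient_mul.
Proof. by move=> a; elim/quotient_ind: a => x; rewrite quotient_mulE mul1g. Qed.

Lemma quotient_1mul : right_id quotient_one quotient_mul.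
Proof. by move=> a; elim/quotient_ind: a => x; rewrite quotient_mulE mulg1. Qed.

Lemma quotient_mulV : left_inverse quotient_one quotient_inv quotient_mul.
Proof.
move=> a; elim/quotient_ind: a => x.
by rewrite quotient_invE quotient_mulE mulVg.
Qed.

Lemma quotient_Vmul : right_inverse quotient_one quotient_inv quotient_mul.
Proof.
move=> a; elim/quotient_ind: a => x.
by rewrite quotient_invE quotient_mulE mulgV.
Qed.

HB.instance Definition _ := isGroup.Build quotient
  quotient_mulA quotient_mul1 quotient_1mul quotient_mulV quotient_Vmul.

Lemma coset_is_morphism : {morph coset : x y / x / y}.
Proof.
move=> x y; have -> : (coset y)^-1 = coset y^-1 by apply: quotient_invE.
by symmetry; apply: quotient_mulE.
Qed.

HB.instance Definition _ := isGroupMorphism.Build G quotient coset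
  coset_is_morphism.

End Quotient.

Section InducedMap.
Variables (G H : groupType) (N : normal_subgroup G) (M : normal_subgroup H).
Variables (phi : {gmorphism G -> H}) (phiNM : N `<=` phi @^-1` M).

(* By inducedE the choice of representatives is immaterial. *)
Definition induced of N `<=` phi @^-1` M : quotient N -> quotient M :=
  fun a => coset M (phi (repr a)).

Lemma inducedE x : induced phiNM (coset N x) = coset M (phi x).
Proof.
apply/coset_eqP; rewrite -gmulfV -gmulfM; apply: phiNM; exact: repr_coset.
Qed.

Lemma induced_is_morphism : {morph induced phiNM : a b / a / b}.
Proof.
move=> a b; elim/quotient_ind: a => x; elim/quotient_ind: b => y.
by rewrite -gmulfF !inducedE -gmulfF -gmulfF.
Qed.

HB.instance Definition _ := isGroupMorphism.Build (quotient N) (quotient M)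
  (induced phiNM) induced_is_morphism.

End InducedMap.

Definition isomorphism (G H : groupType) (f : {gmorphism G -> H}) : Prop :=
  bijective f.

Lemma gamma_normal (G : groupType) i : normal (gamma G i).
Proof.
elim: i => [|[|i] IHi] //; apply: generated_normal => _ z [x gx [y _ <-]].
by rewrite conjRg; exists (x ^ z); [apply: IHi.2|exists (y ^ z)].
Qed.

Definition gammaN (G : groupType) i : normal_subgroup G :=
  NormalSubgroup (gamma_normal G i).

Lemma gamma_morphism (G H : groupType) (phi : {gmorphism G -> H}) i :
  gammaN G i `<=` phi @^-1` gammaN H i.
Proof.
elim: i => [|[|i] IHi] //; apply: generated_min => [|_ [x gx [y _ <-]]] /=.
  have [g1 gF] := (gamma_normal H i.+2).1; split=> [|x y] /=.
    by rewrite gmulf1.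
  by rewrite gmulfF; apply: gF.
rewrite gmulfR; apply: sub_generated; exists (phi x); first exact: IHi.
by exists (phi y).
Qed.

Definition induced_gamma (G H : groupType) (phi : {gmorphism G -> H}) i :
    {gmorphism quotient (gammaN G i) -> quotient (gammaN H i)} :=
  induced (@gamma_morphism G H phi i).

Definition prime_divisors (n : nat) : set nat :=
  [set p | prime p /\ (p %| n)%N].

(* n is a pi'-number; in particular it is positive. *)
Definition prime_to (pi : set nat) (n : nat) : Prop :=
  (0 < n)%N /\ forall p, prime_divisors n p -> ~ pi p.

Definition has_finite_order (G : groupType) (x : G) : Prop :=
  exists2 n : nat, (0 < n)%N & x ^+ n = 1.

(* gamma_i / gamma_(i+1) is the image of gamma_i in G / gamma_(i+1). *)
Definition gamma_factor (G : groupType) i : set (quotient (gammaN G i.+1)) :=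
  coset (gammaN G i.+1) @` gamma G i.
Arguments gamma_factor : clear implicits.

Definition gamma_factor_torsion (G : groupType) i :
    set (quotient (gammaN G i.+1)) :=
  gamma_factor G i `&` [set a | has_finite_order a].
Arguments gamma_factor_torsion : clear implicits.

(* The torsion subgroups are finite when G is finitely generated; an infinite *)
(* one would contribute no prime. *)
Definition tau (G : groupType) : set nat :=
  \bigcup_(i in [set i | (1 <= i)%N])
    [set p | exists2 n : nat,
      gamma_factor_torsion G i #= `I_n & prime_divisors n p].

(* induced_gamma phi 2 is the induced map between abelianizations. *)
Definition lower_central_mono (G H : groupType) (t : set nat)
    (phi : {gmorphism G -> H}) : Prop :=
  [/\ injective phi,
      isomorphism (induced_gamma phi 2) &
      exists n : nat -> nat, forall i, (2 <= i)%N ->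
        prime_to t (n i) /\
        power_subgroup (gamma H i) (n i) `<=` phi @` gamma G i].

Definition para (G H : groupType) (phi : {gmorphism G -> H}) : Prop :=
  injective phi /\ forall i, (1 <= i)%N -> isomorphism (induced_gamma phi i).

(* Main.v *)
Require Import Defs.
From mathcomp Require Import all_boot.
From mathcomp Require Import boolp classical_sets functions cardinality.
From mathcomp Require Import finmap.

(* Since phi is onto modulo gamma_2, the left-normed commutators of weight i   *)
(* in phi(G) generate gamma_i(H) modulo gamma_(i+1)(H), so every phi_i is onto. *)
(* Injectivity of phi_(i+1) follows from that of phi_i: if phi(g) lies in      *)
(* gamma_(i+1)(H), then g lies in gamma_i(G), and some power g^n with n a      *)
(* tau'-number lies in gamma_(i+1)(G). Were g not in gamma_(i+1)(G), a power   *)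
(* of g would have prime order p | n in gamma_i(G)/gamma_(i+1)(G), whose       *)
(* torsion subgroup is finite; hence p would belong to tau.                    *)

Set Implicit Arguments.
Unset Strict Implicit.
Unset Printing Implicit Defensive.

Local Open Scope classical_set_scope.
Local Open Scope card_scope.
Local Open Scope group_scope.

(** Both claims rest on two facts about the factors gamma_i/gamma_(i+1). They are generated by the
    left-normed commutators in any set that generates the group modulo gamma_2
    ([comm_set_generates]); through [generates_mod_gamma] this makes every phi_i onto. For finitely
    generated G they are central and finitely generated, so their torsion is finite
    ([finite_gamma_factor_torsion]); hence tau'-powers detect membership in gamma_(i+1)(G)
    ([gamma_factor_prime_to_tau]), which makes every phi_i injective ([lower_central_mono_gamma]).
    The isomorphisms phi_(i+1) then match the torsion of the factors of G and H, and tau(H) = tau(G)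
    follows. *)

Section SubgroupTheory.
Variable G : groupType.
Implicit Types (K P : set G) (x y z : G).

Lemma subgroupV K x : subgroup K -> K x -> K x^-1.
Proof. by move=> [K1 KF] Kx; rewrite -[x^-1]mul1g; apply: KF. Qed.

Lemma subgroupM K x y : subgroup K -> K x -> K y -> K (x * y).
Proof.
move=> sK Kx Ky; rewrite -[y]invgK; apply: sK.2 => //; exact: subgroupV.
Qed.

Lemma subgroupX K x n : subgroup K -> K x -> K (x ^+ n).
Proof.
move=> sK Kx; elim: n => [|n IHn]; first exact: sK.1.
by rewrite expgS; apply: subgroupM.
Qed.

Lemma subgroup_intro K :
  K 1 -> (forall x, K x -> K x^-1) -> (forall x y, K x -> K y -> K (x * y)) ->
  subgroup K.
Proof. by move=> K1 KV KM; split=> // x y Kx Ky; apply/KM/KV. Qed.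

Lemma commgM_r x y z : [~ x, y * z] = [~ x, z] * [~ x, y] ^ z.
Proof. by rewrite /commg /conjg !(invgM, invgK, mulgA, mulgK, mulgVK, mulgV, mulVg, mul1g). Qed.

Lemma commgM_l x y z : [~ x * y, z] = [~ x, z] ^ y * [~ y, z].
Proof. by rewrite /commg /conjg !(invgM, invgK, mulgA, mulgK, mulgVK, mulgV, mulVg, mul1g). Qed.

Lemma commgV_r x y : [~ x, y^-1] = ([~ x, y] ^ y^-1)^-1.
Proof. by rewrite /commg /conjg !(invgM, invgK, mulgA, mulgK, mulgVK, mulgV, mulVg, mul1g). Qed.

Lemma commgV_l x y : [~ x^-1, y] = ([~ x, y] ^ x^-1)^-1.
Proof. by rewrite /commg /conjg !(invgM, invgK, mulgA, mulgK, mulgVK, mulgV, mulVg, mul1g). Qed.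

End SubgroupTheory.

(** * Generators of the lower central factors *)

Section LowerCentralSeriesTheory.
Variable G : groupType.
Implicit Types (P Y : set G) (x y : G).

Lemma gamma_subgroup i : subgroup (gamma G i).
Proof. by have [] := gamma_normal G i. Qed.

Lemma commg_gamma i x y : gamma G i.+1 x -> gamma G i.+2 [~ x, y].
Proof. by move=> gx; apply: sub_generated; exists x => //; exists y. Qed.

Lemma commg_gamma_r i x y : gamma G i.+1 y -> gamma G i.+2 [~ x, y].
Proof.
move=> gy; rewrite -[[~ x, y]]invgK; apply: (subgroupV (gamma_subgroup i.+2)).
have -> : [~ x, y]^-1 = [~ y, x].
  by rewrite /commg /conjg !(invgM, invgK, mulgA, mulgK, mulgVK, mulgV, mulVg, mul1g).
exact: commg_gamma.
Qed.

Lemma gammaS i : gamma G i.+1 `<=` gamma G i.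
Proof.
case: i => [|i] //; apply: generated_min; first exact: gamma_subgroup.
move=> _ [x gx [y _ <-]]; apply: (subgroupM (gamma_subgroup i.+1)).
  exact: (subgroupV (gamma_subgroup i.+1)).
by apply: (gamma_normal G i.+1).2.
Qed.

(** [P] need not be normal, but conjugation changes an element of gamma_(i+1) only by a factor in
    gamma_(i+2). *)
Lemma gammaJ_mem i P x y : subgroup P -> gamma G i.+2 `<=` P ->
  gamma G i.+1 x -> P x -> P (x ^ y).
Proof.
move=> sP gP gx Px; have -> : x ^ y = x * [~ x, y] by rewrite /commg mulVKg.
by apply: subgroupM => //; apply: gP; apply: commg_gamma.
Qed.

(* Left-normed commutators of weight i in Y; as for gamma, index 0 is a dummy. *)
Fixpoint comm_set Y i : set G :=
  if i isn't j.+1 then setT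
  else if j is _.+1 then [set [~ x, y] | x in comm_set Y j & y in Y] else Y.

Lemma comm_set_gamma Y i : comm_set Y i `<=` gamma G i.
Proof.
elim: i => [|[|i] IHi] //= _ [x cx [y _ <-]].
by apply: commg_gamma; apply: IHi.
Qed.

Lemma comm_set_subgroup Y P i :
  subgroup P -> Y `<=` P -> comm_set Y i.+1 `<=` P.
Proof.
move=> sP YP; elim: i => [|i IHi] //= _ [x /IHi Px [y /YP Py <-]].
by rewrite /commg /conjg; do !apply: subgroupM => //; apply: subgroupV.
Qed.

(* The hypotheses on X and Y say that X generates gamma_(i+1) and Y generates G, *)
(* both modulo gamma_(i+2).                                                    *)
Lemma gamma_comm_step i X Y P :
    X `<=` gamma G i.+1 ->
    (forall K, subgroup K -> X `<=` K -> gamma G i.+2 `<=` K ->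
       gamma G i.+1 `<=` K) ->
    (forall K, subgroup K -> Y `<=` K -> gamma G i.+2 `<=` K -> K = setT) ->
    subgroup P -> [set [~ x, y] | x in X & y in Y] `<=` P ->
    gamma G i.+3 `<=` P ->
  gamma G i.+2 `<=` P.
Proof.
move=> Xg genX genY sP XYP gP; have [P1 _] := sP.
apply: generated_min => // _ [x gx [y _ <-]].
(* The commutator is bilinear modulo gamma_(i+3), so the condition on [u] defines a subgroup and may
   be tested on [X]; for fixed [u] in [X], the condition on the second argument may be tested on
   [Y]. *)
suff: gamma G i.+1 `<=` [set u | gamma G i.+1 u /\ P [~ u, y]].
  by move=> /(_ x gx) [].
have sg := gamma_subgroup i.+1.
apply: genX => [|u Xu|u gu]; last first.
- split; first exact: gammaS.
  by apply: gP; apply: commg_gamma.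
- split; first exact: Xg.
  suff: [set v | P [~ u, v]] = setT by move=> /seteqP[_ /(_ y)]; apply.
  apply: genY => [|v Yv|v gv].
  + apply: subgroup_intro => [|v Pv|v w Pv Pw] /=; first by rewrite commg1.
      rewrite commgV_r; apply: subgroupV => //; apply: (gammaJ_mem _ sP gP) => //.
      by apply: commg_gamma; apply: Xg.
    rewrite commgM_r; apply: subgroupM => //; apply: (gammaJ_mem _ sP gP) => //.
    by apply: commg_gamma; apply: Xg.
  + by apply: XYP; exists u => //; exists v.
  + by apply: gP; apply: commg_gamma_r.
apply: subgroup_intro => [|u [gu Pu]|u v [gu Pu] [gv Pv]] /=.
- by rewrite comm1g; split=> //; apply: sg.1.
- split; first exact: subgroupV.
  rewrite commgV_l; apply: subgroupV => //; apply: (gammaJ_mem _ sP gP) => //.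
  exact: commg_gamma.
split; first exact: subgroupM.
rewrite commgM_l; apply: subgroupM => //; apply: (gammaJ_mem _ sP gP) => //.
exact: commg_gamma.
Qed.

Section Generation.
Variable Y : set G.
Hypothesis genY :
  forall K, subgroup K -> Y `<=` K -> gamma G 2 `<=` K -> K = setT.

Lemma comm_set_generates i K : subgroup K ->
    comm_set Y i.+1 `<=` K -> gamma G i.+2 `<=` K ->
  gamma G i.+1 `<=` K.
Proof.
(* Both claims go through the induction together: [gamma_comm_step] needs [Y] to generate G modulo
   gamma_(i+2), not just modulo gamma_2. *)
suff: (forall K, subgroup K -> comm_set Y i.+1 `<=` K -> gamma G i.+2 `<=` K ->
        gamma G i.+1 `<=` K) /\
      (forall K, subgroup K -> Y `<=` K -> gamma G i.+2 `<=` K -> K = setT).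
  by case=> + _; apply.
elim: i {K} => [|i [IHX IHY]].
  by split=> // K sK YK gK; rewrite (genY sK YK gK).
have IHX' K : subgroup K -> comm_set Y i.+2 `<=` K -> gamma G i.+3 `<=` K ->
    gamma G i.+2 `<=` K.
  exact: (gamma_comm_step (@comm_set_gamma Y i.+1)).
split=> // K sK YK gK; apply: IHY => //; apply: IHX' => //.
exact: comm_set_subgroup.
Qed.

Lemma generates_mod_gamma i K :
  subgroup K -> Y `<=` K -> gamma G i.+2 `<=` K -> K = setT.
Proof.
move=> sK YK; elim: i => [|i IHi] gK; first exact: genY.
by apply: IHi; apply: comm_set_generates => //; apply: comm_set_subgroup.
Qed.

End Generation.

Lemma finite_comm_set Y i : finite_set Y -> finite_set (comm_set Y i.+1).
Proof. by move=> finY; elim: i => [|i IHi] //=; apply: finite_image2. Qed.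

End LowerCentralSeriesTheory.

(** * Torsion in finitely generated central subgroups *)

Section FiniteTorsion.
Variable Q : groupType.
Implicit Types (K A : set Q) (x y z : Q).

Definition central x := forall y, commute x y.

Definition torsion K : set Q := K `&` [set z | has_finite_order z].

Lemma subgroup_central : subgroup [set x | central x].
Proof.
apply: subgroup_intro => [y|x xC y|x y xC yC z] /=.
- exact/commute_sym/commute1.
- exact/commute_sym/commuteV/commute_sym.
- by apply/commute_sym/commuteM; apply: commute_sym.
Qed.

(** Exponents are natural numbers, so an integer power is written as a quotient of two powers. *)
Lemma generated1 x y :
  generated [set x] y -> exists a b : nat, y = x ^+ a / x ^+ b.
Proof.
move: y; apply: generated_min => [|_ ->]; last first.
  by exists 1%N, 0; rewrite expg1 expg0 divg1.
split=> [|_ _ [a [b ->]] [c [d ->]]]; first by exists 0, 0; rewrite divgg.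
exists (a + d)%N, (c + b)%N; rewrite !expgnDr !invgM invgK !mulgA.
congr (_ / _); rewrite -!mulgA; congr (_ * _).
by apply: commute_sym; apply: commuteV; apply: commuteX2.
Qed.

Lemma subgroup_setM K A : subgroup K -> subgroup A ->
    (forall y, A y -> central y) ->
  subgroup [set x * y | x in K & y in A].
Proof.
move=> sK sA AC; split=> [|_ _ [k Kk [w Aw <-]] [l Kl [v Av <-]]].
  by exists 1; [exact: sK.1|exists 1; [exact: sA.1|exact: mulg1]].
exists (k / l); first exact: sK.2; exists (w / v); first exact: sA.2.
have Cwv : central (w / v) by apply: AC; apply: sA.2.
by rewrite invgM -!mulgA; congr (_ * _); rewrite -(Cwv l^-1) mulgA.
Qed.

Lemma generatedU A x : central x ->
  generated (A `|` [set x]) `<=`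
  [set u * v | u in generated A & v in generated [set x]].
Proof.
move=> xC; have sA := generated_subgroup A; have sx := generated_subgroup [set x].
apply: generated_min.
  apply: subgroup_setM => // y; move: y.
  by apply: generated_min => [|_ ->] //; apply: subgroup_central.
move=> y [Ay|->].
  by exists y; [exact: sub_generated|exists 1; [exact: sx.1|exact: mulg1]].
by exists 1; [exact: sA.1|exists x; [exact: sub_generated|exact: mul1g]].
Qed.

Lemma eq_expg_ratio x a b c d :
  (a + d = c + b)%N -> x ^+ a / x ^+ b = x ^+ c / x ^+ d.
Proof.
move=> adE; apply: (mulIg (x ^+ (b + d))).
rewrite {1}expgnDr addnC expgnDr !mulgA !mulgVK.
by rewrite -!expgnDr adE.
Qed.

Lemma expg_ratio_reduce K x m a b : subgroup K -> (0 < m)%N -> K (x ^+ m) ->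
  exists2 j, (j < m)%N & K (x ^+ a / x ^+ b / x ^+ j).
Proof.
(* [c] is congruent to a - b modulo [m]; adding [m * b] keeps the subtraction from truncating. *)
move=> sK m_gt0 Kxm; pose c := (a + (m * b - b))%N.
exists (c %% m)%N; first exact: ltn_pmod.
have -> : x ^+ a / x ^+ b / x ^+ (c %% m) =
          x ^+ m ^+ (c %/ m) / x ^+ m ^+ b.
  rewrite -mulgA -invgM -expgnDr -!expgnA; apply: eq_expg_ratio.
  by rewrite addnA [(_ * (_ %/ _))%N]mulnC -divn_eq -addnA subnK ?leq_pmull.
by apply: sK.2; apply: subgroupX.
Qed.

Lemma finite_torsion_adjoin K x :
    subgroup K -> central x -> (forall k, K k -> central k) ->
    finite_set (torsion K) ->
  finite_set (torsion [set k * w | k in K & w in generated [set x]]).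
Proof.
move=> sK xC KC finK.
(* If a positive power of x lies in K, the new group is a finite union of     *)
(* cosets of K, each containing either no torsion or one torsion coset;       *)
(* otherwise it has no torsion outside K.                                     *)
have [[m m_gt0 Kxm]|noK] := pselect (exists2 m, (0 < m)%N & K (x ^+ m)).
  pose F j := torsion [set k * w | k in K & w in generated [set x]] `&`
              [set y | K (y / x ^+ j)].
  apply: (@sub_finite_set _ _ (\bigcup_(j in `I_m) F j)).
    move=> y [[k Kk [_ /generated1[a [b ->]] yE]] yfin].
    have [j jm Kj] := expg_ratio_reduce a b sK m_gt0 Kxm.
    exists j => //; split; last first.
      by rewrite /= -yE -mulgA; apply: (subgroupM sK).
    split=> //; exists k => //; exists (x ^+ a / x ^+ b) => //.
    have sx := generated_subgroup [set x].
    by apply: sx.2; apply: (subgroupX _ sx); apply: sub_generated.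
  apply: bigcup_finite => [|j _]; first exact: finite_II.
  have [->|/set0P[t [[_ [n n_gt0 tn]] Kt]]] := eqVneq (F j) set0.
    exact: finite_set0.
  apply: (@sub_finite_set _ _ [set u * t | u in torsion K]); last first.
    exact: finite_image.
  move=> y [[_ [p p_gt0 yp]] Ky]; exists (y / t); last by rewrite mulgVK.
  have Kyt : K (y / t).
    by have := sK.2 _ _ Ky Kt; rewrite invgM invgK mulgA mulgVK.
  split=> //; exists (p * n)%N; first by rewrite muln_gt0 p_gt0.
  have tC : commute y t.
    rewrite -(mulgVK t y); apply/commute_sym/commuteM => //.
    exact/commute_sym/KC.
  by rewrite expgnFl // expgnA yp expg1n mulnC expgnA tn expg1n divgg.
apply: sub_finite_set finK => y [[k Kk [_ /generated1[a [b ->]] <-]] yfin].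
have [n n_gt0 yn] := yfin.
have Kw : K ((x ^+ a / x ^+ b) ^+ n).
  have := yn; rewrite expgMn; last exact: KC.
  move/(canRL (mulKg _)); rewrite mulg1 => ->.
  by apply: subgroupV => //; apply: subgroupX.
have Kx : K (x ^+ (a * n) / x ^+ (b * n)).
  by rewrite !expgnA -expgnFl //; apply: commuteX2.
(* By [Kx], distinct [a] and [b] would put a positive power of [x] in [K]. *)
suff ab : a = b by rewrite ab divgg mulg1 in yfin *.
apply/eqP; rewrite eqn_leq; apply/andP; split; rewrite leqNgt; apply/negP => lt_ab;
  apply: noK.
  exists (a * n - b * n)%N; first by rewrite subn_gt0 ltn_pmul2r.
  by rewrite expgnFr // leq_pmul2r // ltnW.
exists (b * n - a * n)%N; first by rewrite subn_gt0 ltn_pmul2r.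
rewrite expgnFr; last by rewrite leq_pmul2r // ltnW.
by have := subgroupV sK Kx; rewrite invgM invgK.
Qed.

(** Adjoining the generators one at a time avoids the structure theorem for abelian groups. *)
Lemma finite_torsion_generated A : finite_set A ->
  (forall y, A y -> central y) -> finite_set (torsion (generated A)).
Proof.
move=> /finite_seqP[s ->]; elim: s => [|x s IHs] sC.
  apply: (@sub_finite_set _ _ [set 1]); last exact: finite_set1.
  move=> y [gy _]; move: y gy; apply: generated_min => //=.
  by split=> // _ _ -> ->; rewrite divgg.
have xC : central x by apply: sC; rewrite /= mem_head.
have sC' y : y \in s -> central y by move=> ys; apply: sC; rewrite /= inE ys orbT.
apply: sub_finite_set (finite_torsion_adjoin _ xC _ (IHs sC')).
- move=> y [gy fy]; split=> //; apply: generatedU => //.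
  move: y gy {fy}; apply: generated_min; first exact: generated_subgroup.
  move=> y /=; rewrite inE => /orP[/eqP->|ys]; apply: sub_generated.
    by right.
  by left.
- exact: generated_subgroup.
- by apply: generated_min; first exact: subgroup_central.
Qed.

(* Multiplication by y permutes K, and all its orbits have size p. *)
Lemma dvdn_card_of_order_prime K n p y : subgroup K -> K #= `I_n ->
  prime p -> K y -> y != 1 -> y ^+ p = 1 -> (p %| n)%N.
Proof.
move=> sK Kn p_pr Ky y1 yp; have finK : finite_set K by apply/finite_setP; exists n.
have memK z : (z \in fset_set K) <-> K z.
  by rewrite in_fset_set //; split => [/set_mem|/mem_set].
have Kf (u : fset_set K) : y * val u \in fset_set K.
  by apply/memK; apply: (subgroupM sK) => //; apply/memK; apply: valP.
pose f (u : fset_set K) : fset_set K := [` Kf u]%fset.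
have fE i u : val (iter i f u) = y ^+ i * val u.
  elim: i => [|i IHi]; first by rewrite mul1g.
  by rewrite iterS /= IHi expgS mulgA.
have f_inj : injective f by move=> u v /(congr1 val)/= /mulgI/val_inj.
have fp u : iter p f u = u by apply: val_inj; rewrite fE yp mul1g.
have ordf u : order f u = p.
  have iterm i : iter (order f u * i) f u = u.
    elim: i => [|i IHi]; first by rewrite muln0.
    by rewrite mulnS iterD IHi iter_order.
  have : (order f u %| p)%N.
    (* The remainder of [p] is then an index of [u] in its own orbit, hence 0. *)
    have modE : iter (p %% order f u) f u = u.
      rewrite -[RHS]fp {2}(divn_eq p (order f u)) addnC iterD mulnC.
      by rewrite iterm.
    by rewrite /dvdn -(findex_iter (ltn_pmod p (order_gt0 f u))) modE findex0.
  move/primeP: p_pr => [_ /[apply]] /orP[/eqP o1|/eqP//].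
  have := iter_order f_inj u; rewrite o1 => /(congr1 val); rewrite fE expg1.
  by move/(canRL (mulgK _)); rewrite divgg => /eqP; rewrite (negbTE y1).
have ordp : predT \subset order_set f p.
  by apply/fintype.subsetP => u _; rewrite inE ordf.
have cardp := fcard_order_set f_inj ordp (fun _ _ _ => erefl).
by rewrite -(card_fset_set Kn) cardfE -[#|_|]cardp dvdn_mull.
Qed.

(** For a prime p dividing n, x^(n/p) has trivial p-th power, hence is trivial, and induction
    applies to n/p. *)
Lemma eq1_of_expg K x n : subgroup K -> K x -> (0 < n)%N ->
    (forall p y, prime p -> (p %| n)%N -> K y -> y ^+ p = 1 -> y = 1) ->
  x ^+ n = 1 -> x = 1.
Proof.
move=> sK Kx; elim/ltn_ind: n => n IHn n_gt0 noK xn.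
have [n1|n1] := leqP n 1%N.
  have n_eq1 : n = 1%N by apply/eqP; rewrite eqn_leq n1.
  by rewrite -[x]expg1 -n_eq1.
have p_pr := pdiv_prime n1; have p_dv := pdiv_dvd n.
apply: (IHn (n %/ pdiv n)%N).
- by rewrite ltn_Pdiv // prime_gt1.
- by rewrite divn_gt0 ?pdiv_gt0 // dvdn_leq.
- by move=> q y q_pr q_dv; apply: noK => //; apply: dvdn_trans q_dv (dvdn_div p_dv).
- apply: (noK (pdiv n)) => //; first exact: subgroupX.
  by rewrite -expgnA divnK.
Qed.

End FiniteTorsion.

Lemma subgroup_torsion (Q : groupType) (K : set Q) : subgroup K ->
  (forall y, K y -> central y) -> subgroup (torsion K).
Proof.
move=> sK KC; split=> [|y z [Ky [m m_gt0 ym]] [Kz [n n_gt0 zn]]].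
  by split; [exact: sK.1|exists 1%N].
split; first exact: sK.2.
exists (m * n)%N; first by rewrite muln_gt0 m_gt0.
rewrite expgnFl; last exact: KC.
by rewrite expgnA ym expg1n mulnC expgnA zn expg1n divgg.
Qed.

Lemma coset_eq1P (G : groupType) (N : normal_subgroup G) x :
  coset N x = 1 <-> normal_set N x.
Proof.
have <- : coset N 1 = 1 by exact: gmulf1.
split=> [/esym/coset_eqP|Nx]; first by rewrite invg1 mul1g.
by apply/esym/coset_eqP; rewrite invg1 mul1g.
Qed.

(** * Torsion of the lower central factors and [tau] *)

Section GammaFactor.
Variable G : groupType.

Lemma gamma_factor_subgroup i : subgroup (gamma_factor G i.+1).
Proof.
have sg := gamma_subgroup G i.+1.
split=> [|_ _ [x gx <-] [y gy <-]].
  by exists 1; [exact: sg.1|exact: gmulf1].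
by exists (x / y); [exact: sg.2|exact: gmulfF].
Qed.

Lemma gamma_factor_central i a : gamma_factor G i.+1 a -> central a.
Proof.
move=> [x gx <-] b; elim/quotient_ind: b => y.
apply/commgP/eqP; rewrite -gmulfR; apply/coset_eq1P; exact: commg_gamma.
Qed.

Lemma finite_gamma_factor_torsion i :
  finitely_generated G -> finite_set (gamma_factor_torsion G i.+1).
Proof.
move=> [Y finY genY]; pose A := coset (gammaN G i.+2) @` comm_set Y i.+1.
have AF : A `<=` gamma_factor G i.+1.
  by move=> _ [x cx <-]; exists x => //; apply: comm_set_gamma cx.
have sA := generated_subgroup A.
apply: sub_finite_set (@finite_torsion_generated _ A _ _).
- move=> a [[x gx <-] fa]; split=> //; move: x gx {fa}.
  (* Applied to the preimage in G of [generated A]. *)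
  apply: (@comm_set_generates _ Y).
  + move=> K sK YK _; apply/seteqP; split=> // x _.
    by apply: generated_min YK _ _ => //; rewrite genY.
  + split=> [|x y Ax Ay] /=; first by rewrite gmulf1; apply: sA.1.
    by rewrite gmulfF; apply: sA.2.
  + by move=> x cx; apply: sub_generated; exists x.
  + by move=> x gx /=; rewrite (coset_eq1P _ _).2 //; apply: sA.1.
- exact/finite_image/finite_comm_set.
- by move=> a /AF/gamma_factor_central.
Qed.

(** [tau] reads primes off a cardinality, so finiteness of the torsion is what puts [p] in it. *)
Lemma tau_of_order_prime i p a : finitely_generated G -> prime p ->
  gamma_factor G i.+1 a -> a != 1 -> a ^+ p = 1 -> tau G p.
Proof.
move=> fgG p_pr Fa a1 ap; exists i.+1 => //=.
have /finite_setP[n cardn] := finite_gamma_factor_torsion i fgG.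
exists n => //; split=> //.
apply: (@dvdn_card_of_order_prime _ (gamma_factor_torsion G i.+1) n p a) => //.
  apply: subgroup_torsion; first exact: gamma_factor_subgroup.
  exact: gamma_factor_central.
by split=> //; exists p; first exact: prime_gt0.
Qed.

Lemma gamma_factor_prime_to_tau i n x : finitely_generated G ->
  prime_to (tau G) n -> gamma G i.+1 x -> gamma G i.+2 (x ^+ n) ->
  gamma G i.+2 x.
Proof.
move=> fgG [n_gt0 n_tau] gx gxn; apply/(coset_eq1P (gammaN G i.+2)).
apply: (eq1_of_expg (gamma_factor_subgroup i) _ n_gt0); first by exists x.
  move=> p a p_pr p_dv Fa ap; apply/eqP/negP => /negP a1.
  by apply: (n_tau p) => //; apply: tau_of_order_prime Fa a1 ap.
by rewrite -gmulfXn; apply/coset_eq1P.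
Qed.

End GammaFactor.

(** * The maps induced by a lower central monomorphism *)

Section LowerCentralMono.
Variables (G H : groupType) (phi : {gmorphism G -> H}).

Lemma induced_gamma_surj i (h : H) :
    isomorphism (induced_gamma phi 2) ->
  exists g, coset (gammaN H i.+2) (phi g) = coset (gammaN H i.+2) h.
Proof.
move=> [f _ fK]; set N := gammaN H i.+2.
pose K := [set h | exists g, coset N (phi g) = coset N h].
suff: K = setT by move/seteqP => [_ /(_ h)]; apply.
(* The image of phi generates H modulo gamma_2 because phi_2 is onto. *)
apply: (@generates_mod_gamma _ (range phi) _ i).
- move=> L sL phiL gL; apply/seteqP; split=> // u _.
  have := fK (coset _ u); elim/quotient_ind: (f _) => g.
  rewrite [induced_gamma _ _ _]inducedE => /coset_eqP /gL Lu.
  rewrite -[u](mulVKg (phi g)); apply: (subgroupM sL) => //.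
  by apply: phiL; exists g.
- split=> [|u v [g gu] [k kv]]; first by exists 1; rewrite gmulf1.
  exists (g / k); rewrite gmulfF; apply: (etrans (gmulfF (coset N) _ _)).
  by apply/esym/(etrans (gmulfF (coset N) _ _)); congr (_ / _).
- by move=> _ [g _ <-]; exists g.
- by move=> u Nu; exists 1; rewrite gmulf1 gmulf1; apply/esym/coset_eq1P.
Qed.

Hypotheses (fgG : finitely_generated G)
  (phi_mono : lower_central_mono (tau G) phi).

Lemma lower_central_mono_gamma i g : gamma H i.+1 (phi g) -> gamma G i.+1 g.
Proof.
have [phi_inj _ [n nP]] := phi_mono.
elim: i g => [|i IHi] g // Hg; have [n_tau nphi] := nP i.+2 isT.
apply: (gamma_factor_prime_to_tau fgG n_tau); first exact/IHi/gammaS.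
have /nphi[k gk] : power_subgroup (gamma H i.+2) (n i.+2) (phi g ^+ n i.+2).
  by apply: sub_generated; exists (phi g).
by rewrite -gmulfXn => /phi_inj <-.
Qed.

Lemma lower_central_mono_para : para phi.
Proof.
have [phi_inj phi2 _] := phi_mono; split=> // i i_gt0.
have inj : injective (induced_gamma phi i).
  apply: gmulf_inj => a; elim/quotient_ind: a => g.
  rewrite [induced_gamma _ _ _]inducedE => /coset_eq1P gg; apply/coset_eq1P.
  by case: i i_gt0 gg => // i _; apply: lower_central_mono_gamma.
have surj b : exists a, induced_gamma phi i a = b.
  elim/quotient_ind: b => h; case: i {inj} i_gt0 => // -[|i] _.
    (* Here the index is 1 and H/gamma_1(H) is trivial. *)
    by exists 1; rewrite gmulf1; apply/esym/coset_eq1P.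
  have [g gE] := induced_gamma_surj i h phi2.
  by exists (coset _ g); rewrite [induced_gamma _ _ _]inducedE.
have /choice[f fK] := surj.
by exists f => // a; apply: inj.
Qed.

Lemma gamma_factor_torsion_image i :
  induced_gamma phi i.+2 @` gamma_factor_torsion G i.+1 =
  gamma_factor_torsion H i.+1.
Proof.
have [_ phi2 _] := phi_mono.
have /bij_inj inj := lower_central_mono_para.2 i.+2 isT.
apply/seteqP; split=> [_ [_ [[g gg <-] [n n_gt0 gn]] <-]|b].
  split; last by exists n => //; rewrite -gmulfXn gn gmulf1.
  rewrite [induced_gamma _ _ _]inducedE; exists (phi g) => //.
  exact: (@gamma_morphism _ _ phi i.+1).
move=> [[h gh <-] [n n_gt0 hn]].
have [g gE] := induced_gamma_surj i h phi2.
have indE : induced_gamma phi i.+2 (coset _ g) = coset _ h.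
  by rewrite [induced_gamma _ _ _]inducedE.
exists (coset _ g) => //; split.
  (* [phi g] agrees with [h] modulo gamma_(i+2)(H), so it lies in gamma_(i+1)(H) as [h] does. *)
  exists g => //; apply: lower_central_mono_gamma.
  have /coset_eqP/gammaS := esym gE.
  by move=> /(subgroupM (gamma_subgroup H i.+1) gh); rewrite mulVKg.
exists n => //; apply: inj; rewrite gmulfXn gmulf1 -hn; congr (_ ^+ n).
exact: indE.
Qed.

Lemma lower_central_mono_tau : tau H = tau G.
Proof.
have cardE i : gamma_factor_torsion G i.+1 #= gamma_factor_torsion H i.+1.
  rewrite card_eq_sym -gamma_factor_torsion_image; apply: inj_card_eq.
  by move=> a b _ _; apply: bij_inj; apply: lower_central_mono_para.2.
apply/seteqP; split=> p [[|i] // _ [n cardn pn]]; exists i.+1 => //; exists n => //.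
  exact: card_eq_trans cardn.
by apply: card_eq_trans cardn; rewrite card_eq_sym.
Qed.

End LowerCentralMono.

Theorem theorem2p2 (G H : groupType)
    (G_fg : finitely_generated G) (H_fg : finitely_generated H)
    (G_rn : residually_nilpotent G) (H_rn : residually_nilpotent H)
    (phi : {gmorphism G -> H})
    (phi_mono : lower_central_mono (tau G) phi) :
  para phi /\ tau H = tau G.
Proof.
split; first exact: lower_central_mono_para.
exact: lower_central_mono_tau phi_mono.
Qed.
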